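(* Let $\mathbf{A}$ be a finite algebra with an edge term. Then there is no infinite strictly ascending chain $V_1 \subsetneq V_2 \subsetneq V_3 \subsetneq \cdots$ of subvarieties of $\mathbb{V}(\mathbf{A})$.
   Context: An algebra is an algebraic structure of some fixed type, i.e. a set with operations interpreting a fixed set of finitary operation symbols. A variety is a class of algebras of a fixed type that consists of all algebras of this type satisfying some (possibly infinite) set of identities $s \approx t$, where $s,t$ are terms. For an algebra $\mathbf{A}$, $\mathbb{V}(\mathbf{A})$ denotes the smallest variety containing $\mathbf{A}$, i.e. the class of all algebras $\mathbf{B}$ of the same type that satisfy all identities satisfied by $\mathbf{A}$. A subvariety of a variety $V$ is a variety (of the same type) contained in $V$. For $k \ge 2$, a function $t : A^{k+1} \to A$ is a $k$-edge operation if for all $x,y \in A$ we have $t(y,y,x,\ldots,x) = t(y,x,y,x,\ldots,x) = x$ and, for all $i \in \{4,\ldots,k+1\}$, $t(x,\ldots,x,y,x,\ldots,x) = x$ with $y$ in position $i$. An algebra has an edge term if, for some $k \ge 2$, one of its term functions is a $k$-edge operation. *)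

(* Defs.v *)
From mathcomp Require Import all_boot.
From mathcomp Require Import boolp classical_sets functions cardinality.

Set Implicit Arguments.
Unset Strict Implicit.
Unset Printing Implicit Defensive.

Local Open Scope classical_set_scope.

Record signature := Signature {
  symbol : Type;
  arity : symbol -> nat }.

(* The carrier may be empty. This does not affect inclusions of varieties: an
   empty algebra (which exists only if no symbol is nullary) satisfies every
   identity, hence belongs to every variety. *)
Record algebra (S : signature) := Algebra {
  carrier :> Type;
  interp : forall f : symbol S, ('I_(arity f) -> carrier) -> carrier }.

Inductive term (S : signature) (X : Type) : Type :=
| Var of X
| App (f : symbol S) of ('I_(arity f) -> term S X).

Fixpoint eval (S : signature) (A : algebra S) (X : Type) (v : X -> A)
    (t : term S X) : A :=
  match t with
  | Var x => v x
  | App f ts => interp (fun i => eval v (ts i))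
  end.

(* An identity s ~ t, over a fixed countably infinite set of variables, is the
   pair (s, t). *)
Definition identity (S : signature) : Type := (term S nat * term S nat)%type.

Definition satisfies (S : signature) (A : algebra S) (e : identity S) : Prop :=
  forall v : nat -> A, eval v e.1 = eval v e.2.

Definition models (S : signature) (E : set (identity S)) : set (algebra S) :=
  [set B | forall e, E e -> satisfies B e].

Definition is_variety (S : signature) (V : set (algebra S)) : Prop :=
  exists E : set (identity S), V = models E.

Definition variety_of (S : signature) (A : algebra S) : set (algebra S) :=
  models [set e | satisfies A e].

Lemma variety_of_smallest (S : signature) (A : algebra S) :
  [/\ is_variety (variety_of A), variety_of A A &
      forall V, is_variety V -> V A -> variety_of A `<=` V].
Proof.
split; [by exists [set e | satisfies A e] | by [] |].
by move=> _ [E ->] AE B AB e /AE; apply: AB.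
Qed.

Definition is_subvariety (S : signature) (W V : set (algebra S)) : Prop :=
  is_variety W /\ W `<=` V.

Definition is_term_function (S : signature) (A : algebra S) (n : nat)
    (g : ('I_n -> A) -> A) : Prop :=
  exists t : term S 'I_n, forall v, g v = eval v t.

(* Positions are numbered from 0 here, so that position i of the literature is
   index i - 1. *)
Definition is_edge_operation (T : Type) (k : nat)
    (g : ('I_k.+1 -> T) -> T) : Prop :=
  forall x y : T,
    [/\ g (fun j => if (j == 0 :> nat) || (j == 1 :> nat) then y else x) = x,
        g (fun j => if (j == 0 :> nat) || (j == 2 :> nat) then y else x) = x &
        forall i : 'I_k.+1, 3 <= i -> g (fun j => if j == i then y else x) = x].

Definition has_edge_term (S : signature) (A : algebra S) : Prop :=
  exists (k : nat) (g : ('I_k.+1 -> A) -> A),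
    [/\ 2 <= k, is_term_function g & is_edge_operation g].

(* Main.v *)
Require Import Defs.
From mathcomp Require Import all_boot all_order.
From mathcomp Require Import boolp classical_sets functions cardinality.

Set Implicit Arguments.
Unset Strict Implicit.
Unset Printing Implicit Defensive.

Local Open Scope classical_set_scope.

(** Subvarieties of V(A) are governed by sets of finite functions.  Let Th(V)
    be the set of identities valid in V.  For V inside V(A), whether (s, t) is
    in Th(V) depends only on the n-ary term functions that s and t induce on A,
    so Th(V) is encoded by the functions A^n -> A x A sending w to (s(w), t(w)).
    These functions form a clonoid: for each n they are closed under the edge
    operation of A x A, and across arities they are closed under minors
    (identifying, permuting and adding variables).  Since V |-> Th(V) reverses
    inclusions, it suffices that a descending chain C_0, C_1, ... of clonoids
    into a finite algebra with an edge term has two equal consecutive members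
    ([clonoid_chain_stops]).

    Two facts give this.  First, order A^n lexicographically, and say that F
    has the fork (u(a), v(a)) at a if u and v are in F and agree strictly below
    a.  If F is contained in G, both are closed under a k-edge operation, they
    have the same forks, and every member of G agrees with a member of F on any
    k points, then F = G ([forks_determine_subpower]).  Hence each proper
    inclusion in the chain is witnessed by finite data: a fork p at a word a
    that is lost from C_i to C_(i+1), or a lost tuple of values on k words.

    Second, these data are well-quasi-ordered.  If the word b arises from a by
    repeating letters so that the first occurrences come in the order of a,
    then taking minors turns every fork at b into a fork at a ([fork_minor]);
    Higman's lemma, applied to words whose letters are marked as first
    occurrences or not, provides such a pair among infinitely many words
    ([higman], [mark_subseq_reindex]).  For values on k words only the finite
    set of columns of the k x n matrix matters ([columns_minor]).  So an
    infinite strictly descending chain would lose at some step j a fork, or a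
    tuple of values, which a minor carries back to one already lost at an
    earlier step i; since C_j is contained in C_(i+1), this is absurd. *)

(** * Edge operations, forks and interpolation *)

Definition closed_under (I D : Type) (k : nat) (t : ('I_k -> D) -> D)
    (F : set (I -> D)) : Prop :=
  forall fs : 'I_k -> I -> D, (forall j, F (fs j)) ->
    F (fun x => t (fun j => fs j x)).

Section EdgeOperation.

Variables (D : Type) (k : nat) (t : ('I_k.+1 -> D) -> D).
Hypothesis edge_t : is_edge_operation t.

Lemma edge01 (r : 'I_k.+1 -> D) (x y : D) :
  (forall j : 'I_k.+1, r j = if j < 2 then y else x) -> t r = x.
Proof.
move=> rE; case: (edge_t x y) => <- _ _; congr t; apply/funext => j.
by rewrite rE; case: j => [[|[|j]] lt_j].
Qed.

Lemma edge02 (r : 'I_k.+1 -> D) (x y : D) :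
  (forall j : 'I_k.+1, r j = if (j == 0 :> nat) || (j == 2 :> nat) then y else x) ->
  t r = x.
Proof. by move=> rE; case: (edge_t x y) => _ <- _; congr t; apply/funext. Qed.

(** A position [p] beyond the arity is allowed and means that all arguments are
    equal to [x]; this treats coordinates without a disagreement uniformly. *)
Lemma edge_ge3 (r : 'I_k.+1 -> D) (x : D) (p : nat) : 3 <= p ->
  (forall j : 'I_k.+1, j != p :> nat -> r j = x) -> t r = x.
Proof.
move=> p3 rx; case: (ltnP p k.+1) => [ltp | gep].
  have [_ _ /(_ (Ordinal ltp) p3) tx] := edge_t x (r (Ordinal ltp)).
  rewrite -[RHS]tx.
  by congr t; apply/funext => j; case: eqP => [-> // | /eqP jp]; rewrite rx.
apply: (@edge01 _ _ x) => j; rewrite if_same rx // neq_ltn.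
by rewrite (leq_trans (ltn_ord j) gep).
Qed.

Variables (I : eqType) (F : set (I -> D)).
Hypothesis closedF : closed_under t F.

(** The member [f] of [F] interpolates [g] on [T], and [u], [v] are a fork
    leading from the value of [f] to that of [g] at the next point [a]; the
    conclusion repairs [f] at [a].  By induction on the size of [T] there are
    members [w p] of [F] that agree with [g] on [a] and on [T], except perhaps
    at the [p]-th point of [T].  A single use of the edge operation [t] would
    finish if [F] contained two functions with the same value at [a], one equal
    to [g] on [T] and the other equal to [w 0] there.  Such a pair is
      [h := t (w 0, w 0, f, w 1, ..., w (k - 2))] and
      [m := t (v, w 0, u, w 0, ..., w 0)]:
    at [a] both are equal to [t (x, x, z, x, ..., x)], where [x := g a] and
    [z := f a].  Then
      [t (m, h, w 0, w 1, ..., w (k - 2))]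
    agrees with [g] on [a :: T]. *)
Lemma interpolation_step (g f u v : I -> D) (T : seq I) (a : I) :
    2 <= k ->
    (forall l : 'I_k -> I, exists2 q, F q & forall i, q (l i) = g (l i)) ->
    F f -> {in T, f =1 g} ->
    F u -> F v -> {in T, u =1 v} -> u a = f a -> v a = g a ->
  exists2 q, F q & {in a :: T, q =1 g}.
Proof.
move=> k2 proj Ff fg Fu Fv uv ufa vga.
have [n] := ubnP (size T); elim: n T fg uv => // n IHn T fg uv sT.
have [T_small | T_large] := ltnP (size T) k.
  have [q Fq qg] := proj (fun i => nth a (a :: T) i); exists q => // c cT.
  have ltc : index c (a :: T) < k by apply: leq_trans T_small; rewrite index_mem.
  by have := qg (Ordinal ltc); rewrite /= nth_index.
pose minus p := take p T ++ drop p.+1 T.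
have sub_minus p : {subset minus p <= T}.
  by move=> c; rewrite mem_cat => /orP[/mem_take | /mem_drop].
have in_minus p c : c \in T -> index c T != p -> c \in minus p.
  move=> cT; rewrite mem_cat neq_ltn => /orP[ltp | gtp].
    by rewrite in_take // ltp.
  apply/orP; right; rewrite -{1}(nth_index a cT) -(subnKC gtp) -nth_drop.
  rewrite mem_nth //.
  by rewrite size_drop ltn_sub2r ?index_mem // (leq_ltn_trans gtp) ?index_mem.
(* Beyond the size of [T] there is no point to omit, and [f] is a dummy. *)
have /choice[w /all_and2[Fw wg]] p :
    exists q, F q /\ (p < size T -> {in a :: minus p, q =1 g}).
  have [ltp | _] := ltnP p (size T); last by exists f.
  have [] := IHn (minus p).
  - by move=> c /sub_minus; apply: fg.
  - by move=> c /sub_minus; apply: uv.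
  - apply: (@leq_trans (size T)); last by rewrite -ltnS.
    by rewrite size_cat size_take size_drop ltp -addSn subnKC.
  by move=> q Fq qg; exists q.
have wa p : p.+1 < k -> w p a = g a.
  by move=> ltp; rewrite wg ?mem_head // (leq_trans _ T_large) // ltnW.
have wT p c : p.+1 < k -> c \in T -> index c T != p -> w p c = g c.
  move=> ltp cT nc; rewrite wg ?in_cons ?in_minus ?orbT //.
  by rewrite (leq_trans _ T_large) // ltnW.
have ltj (j : 'I_k.+1) : 2 < j -> (j - 2).+1 < k.
  by case: j => [[|[|[|j]]] lj] //= _; rewrite !subSS subn0.
pose hs (j : 'I_k.+1) := if j < 2 then w 0 else if j == 2 :> nat then f else w (j - 2).
pose h x := t (fun j => hs j x).
pose ms (j : 'I_k.+1) := if j == 0 :> nat then v else if j == 2 :> nat then u else w 0.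
pose m x := t (fun j => ms j x).
pose qs (j : 'I_k.+1) :=
  if j == 0 :> nat then m else if j == 1 :> nat then h
  else if j == 2 :> nat then w 0 else w (j - 2).
have Fh : F h by apply: closedF => j; rewrite /hs; do 2?case: ifP.
have Fm : F m by apply: closedF => j; rewrite /ms; do 2?case: ifP.
exists (fun x => t (fun j => qs j x)).
  by apply: closedF => j; rewrite /qs; do 3?case: ifP.
have hg c : c \in T -> h c = g c.
  move=> cT; have [c0 | c0] := eqVneq (index c T) 0.
    apply: (@edge01 _ _ (w 0 c)) => j; rewrite /hs; case: ltnP => // j2.
    case: eqP => [_ | /eqP nj2]; first exact: fg.
    have j3 : 2 < j by rewrite ltn_neqAle eq_sym nj2.
    by apply: wT; rewrite ?ltj // c0 neq_ltn subn_gt0 j3.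
  apply: (@edge_ge3 _ _ (index c T).+2) => [|j nj].
    by rewrite !ltnS lt0n.
  rewrite /hs; case: ltnP => j2; first by rewrite wT.
  case: eqP => [_ | /eqP nj2]; first exact: fg.
  have j3 : 2 < j by rewrite ltn_neqAle eq_sym nj2.
  apply: wT; rewrite ?ltj //; apply: contra nj => /eqP ->.
  by rewrite -addn2 subnK.
have mw c : c \in T -> m c = w 0 c.
  move=> cT; apply: (@edge02 _ _ (u c)) => j; rewrite /ms.
  by case: eqP => [_ | _]; [rewrite uv | case: eqP].
have mh : m a = h a.
  congr t; apply/funext => j; rewrite /ms /hs.
  case: j => [[|[|[|j]]] lj] //=.
  - by rewrite vga wa.
  - by rewrite !wa // (ltj (Ordinal lj)).
move=> c; rewrite in_cons => /predU1P[-> | cT].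
  apply: (@edge01 _ _ (h a)) => j; rewrite /qs.
  case: j => [[|[|[|j]]] lj] //=; first by rewrite wa.
  by rewrite wa // (ltj (Ordinal lj)).
have [c0 | c0] := eqVneq (index c T) 0.
  apply: (@edge02 _ _ (w 0 c)) => j; rewrite /qs.
  case: j => [[|[|[|j]]] lj] //=; first exact: mw.
    exact: hg.
  by rewrite wT ?(ltj (Ordinal lj)) // c0.
apply: (@edge_ge3 _ _ (index c T).+2) => [|j]; first by rewrite !ltnS lt0n.
rewrite /qs; case: j => [[|[|[|j]]] lj] //= nj.
- by rewrite mw // wT.
- exact: hg.
- by rewrite wT.
by rewrite wT ?(ltj (Ordinal lj)) //; apply: contra nj; rewrite !eqSS subn2 /= => /eqP->.
Qed.

End EdgeOperation.

(** The pairs of values at [a] of two members of [F] that first differ at [a]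
    or later, as in the compact representations of subpowers. *)
Definition fork (d : Order.disp_t) (I : porderType d) (D : Type)
    (F : set (I -> D)) (a : I) : set (D * D) :=
  [set p | exists u v, [/\ F u, F v, forall c, (c < a)%O -> u c = v c & p = (u a, v a)]].

(** A member of [G] is interpolated by members of [F] on larger and larger
    initial segments of [I]: if [f] in [F] agrees with [g] in [G] below [a],
    then [(f a, g a)] is a fork of [G], hence of [F], and
    [interpolation_step] applies. *)
Lemma forks_determine_subpower (d : Order.disp_t) (I : finOrderType d)
    (x0 : I) (D : Type) (k : nat) (t : ('I_k.+1 -> D) -> D) (F G : set (I -> D)) :
    2 <= k -> is_edge_operation t -> closed_under t F -> F `<=` G ->
    (forall a, fork G a `<=` fork F a) ->
    (forall g, G g -> forall l : 'I_k -> I,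
       exists2 q, F q & forall i, q (l i) = g (l i)) ->
  G `<=` F.
Proof.
move=> k2 edge_t closedF sFG forkGF proj g Gg.
suff ind n (S : {set I}) : #|S| < n ->
    (forall a c, a \in S -> (c < a)%O -> c \in S) ->
    exists2 f, F f & {in S, f =1 g}.
  have [||f Ff fg] := ind #|I|.+1 [set: I]%SET.
  - by rewrite cardsT.
  - by move=> a c _ _; rewrite finset.in_setT.
  by have <- : f = g by apply/funext => x; apply: fg; rewrite finset.in_setT.
elim: n S => // n IHn S cardS downS.
have [-> | [a0 a0S]] := set_0Vmem S.
  by have [q Fq _] := proj g Gg (fun=> x0); exists q => // y; rewrite finset.in_set0.
pose a := [arg max_(i > a0 in S) i]%O.
have [aS a_max] : a \in S /\ forall c, c \in S -> (c <= a)%O.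
  by rewrite /a; case: Order.TotalTheory.arg_maxP.
have [|| f Ff fg] := IHn (S :\ a)%SET.
- by rewrite -ltnS; apply: leq_trans cardS; rewrite [X in _ < X.+1](cardsD1 a) aS.
- move=> b c; rewrite !inE => /andP[nba bS] cb; rewrite (downS b) // andbT.
  by rewrite Order.POrderTheory.lt_eqF // (Order.POrderTheory.lt_le_trans cb) ?a_max.
have below c : (c < a)%O -> f c = g c.
  by move=> ca; apply: fg; rewrite !inE Order.POrderTheory.lt_eqF //= (downS a).
have [u [v [Fu Fv uv [ufa vga]]]] : fork F a (f a, g a).
  by apply: forkGF; exists f, g; split => //; apply: sFG.
have [||q Fq qg] := interpolation_step edge_t closedF
   (T := [seq c <- enum I | (c < a)%O]) k2 (proj g Gg) Ff _ Fu Fv _ (esym ufa) (esym vga).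
- by move=> c; rewrite mem_filter => /andP[/below].
- by move=> c; rewrite mem_filter => /andP[/uv].
exists q => // c cS; apply: qg; rewrite in_cons mem_filter mem_enum andbT.
by rewrite -Order.POrderTheory.le_eqVlt a_max.
Qed.

(** * Higman's lemma for labelled words *)

Lemma infinite_pigeonhole (C : finType) (col : nat -> C) :
  exists c, exists2 phi : nat -> nat,
    {homo phi : i j / i < j} & forall i, col (phi i) = c.
Proof.
have [c often] : exists c, forall N, exists2 n, N <= n & col n = c.
  apply: contrapT => /forallNP rare.
  have /choice[N rareN] c : exists N, forall n, N <= n -> col n <> c.
    have /existsNP[N noN] := rare c; exists N => n Nn colc.
    by apply: noN; exists n.
  by apply: (rareN (col (\max_c N c)) (\max_c N c)); rewrite ?leq_bigmax.
have /choice[nx nxP] N : exists n, N <= n /\ col n = c.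
  by have [n] := often N; exists n.
pose phi := fix phi i := if i is j.+1 then nx (phi j).+1 else nx 0.
exists c, phi; last by case=> [|i]; exact: (nxP _).2.
by apply: homo_ltn => [j i l | i]; [exact: ltn_trans | exact: (nxP _).1].
Qed.

(** The minimal bad sequence argument of Nash-Williams, for an arbitrary
    relation and a size function. *)
Section MinimalBadSequence.

Variables (T : Type) (R : T -> T -> Prop) (size : T -> nat).

Definition bad (u : nat -> T) : Prop := forall i j, i < j -> ~ R (u i) (u j).

Lemma minimal_bad_sequence (u : nat -> T) : bad u ->
  exists2 m, bad m & forall n v, bad v -> (forall i, i < n -> v i = m i) ->
    size (m n) <= size (v n).
Proof.
move=> bad_u.
pose agree n (v w : nat -> T) := forall i, i < n -> v i = w i.
have step (nv : nat * (nat -> T)) : exists w, bad nv.2 ->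
    [/\ bad w, agree nv.1 w nv.2 &
      forall w', bad w' -> agree nv.1 w' nv.2 -> size (w nv.1) <= size (w' nv.1)].
  case: nv => n v /=.
  have [bad_v | ] := pselect (bad v); last by exists v.
  pose P s := `[< exists w, [/\ bad w, agree n w v & size (w n) = s] >].
  have exP : exists s, P s by exists (size (v n)); apply/asboolP; exists v.
  case: (ex_minnP exP) => s /asboolP[w [bad_w wv <-]] w_min.
  exists w => _; split=> // w' bad_w' w'v.
  by apply: w_min; apply/asboolP; exists w'.
have [next nextP] := choice step.
(* [U n] is a bad sequence whose first [n] entries are final; the minimal bad
   sequence is the diagonal. *)
pose U := fix U n := if n is p.+1 then next (p, U p) else u.
have badU n : bad (U n).
  by elim: n => // n IHn; have [] := nextP (n, U n) IHn.
have agreeU n p : agree n (U (n + p)) (U n).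
  elim: p => [|p IHp] i lt_in; first by rewrite addn0.
  have [_ same _] := nextP (n + p, U (n + p)) (badU _).
  by rewrite addnS -IHp //= same //= (leq_trans lt_in) ?leq_addr.
have agreeU' n p i : i < n -> n <= p -> U p i = U n i.
  by move=> lt_in le_np; rewrite -(subnKC le_np) agreeU.
exists (fun n => U n.+1 n) => [i j lt_ij | n v bad_v vm].
  by rewrite -(@agreeU' i.+1 j.+1) //; [exact: badU | exact: ltnW].
have [_ _ ] := nextP (n, U n) (badU n); apply => //= i lt_in.
by rewrite vm // -(@agreeU' i.+1 n).
Qed.

End MinimalBadSequence.

Definition higman_le (L Y : eqType) (p q : L * seq Y) : Prop :=
  p.1 = q.1 /\ subseq p.2 q.2.

(** In a minimal bad sequence infinitely many entries share the label and the
    first letter (two empty entries with the same label are comparable).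
    Deleting this letter from them, and dropping the other entries from the
    first of them on, gives a smaller bad sequence. *)
Lemma higman (L Y : finType) (u : nat -> L * seq Y) :
  exists i j, i < j /\ higman_le (u i) (u j).
Proof.
apply: contrapT => none.
have bad_u : bad (@higman_le L Y) u.
  by move=> i j lt_ij uij; apply: none; exists i, j.
have [m bad_m m_min] := minimal_bad_sequence (fun p => size p.2) bad_u.
have [[l [y|]] [phi phi_mono phiE]] :=
    infinite_pigeonhole (fun n => ((m n).1, ohead (m n).2)); last first.
  case: (bad_m _ _ (phi_mono 0 1 isT)).
  have := phiE 0; have := phiE 1; rewrite /higman_le.
  by case: (m _) (m _) => [l1 [|? ?]] [l0 [|? ?]] // [->] [->].
have mphi i : m (phi i) = (l, y :: behead (m (phi i)).2).
  by have := phiE i; case: (m _) => l0 [|y0 w] //= [-> ->].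
pose v n := if n < phi 0 then m n else (l, behead (m (phi (n - phi 0))).2).
have bad_v : bad (@higman_le L Y) v.
  move=> i j lt_ij; rewrite /v; case: (ltnP j) => [lt_j | le_j].
    by rewrite (ltn_trans lt_ij lt_j); apply: bad_m.
  case: (ltnP i) => [lt_i | le_i] [/= eq_l sub].
    apply: (@bad_m i (phi (j - phi 0))).
      apply: leq_trans lt_i _; have [->|pos] := posnP (j - phi 0); first by [].
      exact/ltnW/phi_mono.
    rewrite mphi; split=> //; apply: subseq_trans sub _; exact: subseq_cons.
  apply: (@bad_m (phi (i - phi 0)) (phi (j - phi 0))).
    by apply: phi_mono; rewrite ltn_sub2rE.
  by rewrite (mphi (i - _)) (mphi (j - _)); split=> //=; rewrite eqxx.
have same i : i < phi 0 -> v i = m i by rewrite /v => ->.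
by have := m_min _ v bad_v same; rewrite /v ltnn subnn mphi /= ltnn.
Qed.

(** * Minors, forks and chains of clonoids *)

(** Each letter carries a flag telling whether it has occurred before, [seen]
    being the letters that precede the word. *)
Fixpoint mark (X : eqType) (seen w : seq X) : seq (X * bool) :=
  if w is x :: w' then (x, x \in seen) :: mark (x :: seen) w' else [::].

Lemma mark_rcons (X : eqType) (seen w : seq X) (y : X) :
  mark seen (rcons w y) = rcons (mark seen w) (y, y \in seen ++ w).
Proof.
elim: w seen => [|x w IHw] seen /=; first by rewrite cats0.
by rewrite IHw !(mem_cat, in_cons) orbCA orbA.
Qed.

Lemma subseq_rcons2 (T : eqType) (s1 s2 : seq T) (x y : T) :
  subseq (rcons s1 x) (rcons s2 y) =
    if x == y then subseq s1 s2 else subseq (rcons s1 x) s2.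
Proof.
rewrite -subseq_rev !rev_rcons /= -rev_rcons.
by case: eqP => _; rewrite subseq_rev.
Qed.

(** [sigma] is onto, and the first occurrences of its values come in increasing
    order. *)
Definition orderly (m n : nat) (sigma : 'I_n -> 'I_m) : Prop :=
  forall i, exists2 j, sigma j = i & forall j' : 'I_n, j' < j -> sigma j' < i.

(** The letters of [b] that are matched by the embedding of [a] are sent to
    their partners, every other letter to a position of [a] with the same
    letter.  That position must precede the partner of any later matched letter;
    the flags ensure that the letter of [b] has already been matched, since
    otherwise a letter new in [a] would be matched to one that is old in [b]. *)
Lemma mark_subseq_reindex_nat (X : eqType) (a b : seq X) :
    subseq (mark [::] a) (mark [::] b) -> {subset b <= a} ->
  exists sigma : nat -> nat,
    (forall j, j < size b -> sigma j < size a /\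
       forall x0, nth x0 b j = nth x0 a (sigma j)) /\
    (forall i, i < size a -> exists j, [/\ j < size b, sigma j = i &
       forall j', j' < j -> sigma j' < i]).
Proof.
elim/last_ind: b a => [|b y IHb] a.
  by case: a => [_ _ | x a] //; exists id.
case/lastP: a => [_ /(_ y) | a x]; first by rewrite mem_rcons mem_head => /(_ isT).
rewrite !mark_rcons subseq_rcons2 xpair_eqE; case: ifP => [/andP[/eqP<- /eqP/= old] | _].
  move=> sub_ab sub_ba.
  have [|sigma [sigma_ba sigma_ord]] := IHb a sub_ab.
    move=> z zb; have := sub_ba z; rewrite !mem_rcons !in_cons zb orbT => /(_ isT).
    by case: eqP zb => [-> | _]; rewrite ?old.
  exists (fun j => if j < size b then sigma j else size a); split=> [j | i].
    rewrite size_rcons ltnS leq_eqVlt => /predU1P[-> | ltj].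
      by rewrite ltnn size_rcons ltnS; split=> // x0; rewrite !nth_rcons !ltnn !eqxx.
    have [lt_a eq_ab] := sigma_ba j ltj; rewrite ltj size_rcons ltnS ltnW //.
    by split=> // x0; rewrite !nth_rcons ltj lt_a.
  rewrite !size_rcons ltnS leq_eqVlt => /predU1P[-> | lti].
    exists (size b); rewrite ltnSn ltnn; split=> // j' ltj'; rewrite ltj'.
    by have [] := sigma_ba j' ltj'.
  have [j [ltj sji ord]] := sigma_ord i lti; exists j; rewrite ltj ltnS ltnW //.
  by split=> // j' lt_j'; rewrite (ltn_trans lt_j' ltj); apply: ord.
rewrite -mark_rcons; set ax := rcons a x => sub_ab sub_ba.
have [|sigma [sigma_ba sigma_ord]] := IHb ax sub_ab.
  by move=> z zb; apply: sub_ba; rewrite mem_rcons in_cons zb orbT.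
have yax : y \in ax by apply: sub_ba; rewrite mem_rcons mem_head.
exists (fun j => if j < size b then sigma j else index y ax); split=> [j | i lti].
  rewrite size_rcons ltnS leq_eqVlt => /predU1P[-> | ltj].
    by rewrite ltnn index_mem yax; split=> // x0; rewrite nth_rcons ltnn eqxx nth_index.
  have [lt_a eq_ab] := sigma_ba j ltj; rewrite ltj.
  by split=> // x0; rewrite nth_rcons ltj.
have [j [ltj sji ord]] := sigma_ord i lti; exists j; rewrite ltj size_rcons ltnS ltnW //.
by split=> // j' lt_j'; rewrite (ltn_trans lt_j' ltj); apply: ord.
Qed.

Lemma mark_subseq_reindex (X : eqType) (m n : nat) (a : m.-tuple X) (b : n.-tuple X) :
    subseq (mark [::] a) (mark [::] b) -> {subset b <= a} ->
  exists2 sigma : 'I_n -> 'I_m, orderly sigma &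
    b = [tuple tnth a (sigma j) | j < n].
Proof.
move=> sub_ab sub_ba.
have [s []] := mark_subseq_reindex_nat sub_ab sub_ba.
rewrite !size_tuple => s_ba s_ord.
exists (fun j : 'I_n => Ordinal (s_ba j (ltn_ord j)).1).
  move=> i; have [j [ltj sji ord]] := s_ord i (ltn_ord i).
  by exists (Ordinal ltj) => [|j' lt_j']; [apply: val_inj | apply: ord].
apply: eq_from_tnth => j; rewrite tnth_mktuple.
have x0 := tnth b j; rewrite !(tnth_nth x0) /=.
by rewrite (s_ba j (ltn_ord j)).2.
Qed.

Definition minor (X : Type) (m n : nat) (sigma : 'I_n -> 'I_m) (w : m.-tuple X) :
    n.-tuple X :=
  [tuple tnth w (sigma j) | j < n].

(** If [c] and [a] first differ at [i], then their minors first differ at the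
    first occurrence of [i] as a value of [sigma]. *)
Lemma minor_lt (d : Order.disp_t) (X : porderType d) (m n : nat)
    (sigma : 'I_n -> 'I_m) (c a : m.-tuplelexi X) :
  orderly sigma -> (c < a)%O ->
  ((minor sigma c : n.-tuplelexi X) < (minor sigma a : n.-tuplelexi X))%O.
Proof.
move=> ord_sigma /ltxi_tuplePlt[i eq_ca lt_ca].
have [j sji ord] := ord_sigma i.
apply/ltxi_tuplePlt; exists j => [j' lt_j'|]; rewrite !tnth_mktuple ?sji //.
exact/eq_ca/ord.
Qed.

Definition minor_closed (X D : Type) (F : forall n, set (n.-tuple X -> D)) : Prop :=
  forall m n (sigma : 'I_n -> 'I_m) f, F n f -> F m (f \o minor sigma).

Lemma fork_minor (d : Order.disp_t) (X : porderType d) (D : Type)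
    (F : forall n, set (n.-tuplelexi X -> D)) (m n : nat) (sigma : 'I_n -> 'I_m)
    (a : m.-tuplelexi X) :
  minor_closed F -> orderly sigma ->
  fork (F n) (minor sigma a : n.-tuplelexi X) `<=` fork (F m) a.
Proof.
move=> minF ord_sigma _ [u [v [Fu Fv uv ->]]].
exists (u \o minor sigma), (v \o minor sigma); split=> //; do ?exact: minF.
by move=> c lt_ca; apply: uv; apply: minor_lt.
Qed.

(** The rows [l i] form a k x n matrix; its columns are taken as a set, so
    their order and multiplicity are forgotten. *)
Definition columns (X : finType) (k n : nat) (l : 'I_k -> n.-tuple X) :
    {set k.-tuple X} :=
  [set [tuple tnth (l i) j | i < k] | j : 'I_n]%SET.

Lemma columns_minor (X : finType) (k m n : nat)
    (l : 'I_k -> m.-tuple X) (l' : 'I_k -> n.-tuple X) :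
  columns l' = columns l ->
  exists sigma : 'I_n -> 'I_m, forall i, minor sigma (l i) = l' i.
Proof.
move=> eq_col.
have /choice[sigma sigmaP] j : exists j' : 'I_m, forall i, tnth (l i) j' = tnth (l' i) j.
  have /imsetP[j' _ eq_j] : [tuple tnth (l' i) j | i < k] \in columns l.
    by rewrite -eq_col; apply: imset_f.
  by exists j' => i; have := congr1 (fun c => tnth c i) eq_j; rewrite !tnth_mktuple.
by exists sigma => i; apply: eq_from_tnth => j; rewrite tnth_mktuple.
Qed.

(** If no inclusion were an equality, each step would lose a fork or the values
    on some [k] words.  The witness of a loss is recorded as a labelled word: for
    a fork the marked word, labelled by its set of letters and the fork; for
    values on [k] words the empty word, labelled by the columns and the values.
    Higman's lemma makes two losses comparable, which is impossible. *)
Theorem clonoid_chain_stops (d : Order.disp_t) (X : finOrderType d) (x0 : X)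
    (D : finType) (k : nat) (t : ('I_k.+1 -> D) -> D)
    (C : nat -> forall n, set (n.-tuplelexi X -> D)) :
    2 <= k -> is_edge_operation t ->
    (forall i n, closed_under t (C i n)) -> (forall i, minor_closed (C i)) ->
    (forall i n, C i.+1 n `<=` C i n) ->
  exists i, forall n, C i n `<=` C i.+1 n.
Proof.
move=> k2 edge_t closedC minC decC.
have decC_lt i j n : i < j -> C j n `<=` C i.+1 n.
  move=> lt_ij; rewrite -(subnKC lt_ij); elim: (j - i.+1) => [|p IHp].
    by rewrite addn0.
  by rewrite addnS; apply: subset_trans IHp; apply: decC.
apply: contrapT => /forallNP strict.
pose label : finType :=
  (({set k.-tuple X} * {ffun 'I_k -> D}) + ({set X} * (D * D)))%type.
pose lost_rows i (S : {set k.-tuple X}) (r : {ffun 'I_k -> D}) := exists n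
   (l : 'I_k -> n.-tuple X), [/\ columns l = S,
    exists2 f, C i n f & forall s, f (l s) = r s &
    ~ exists2 f, C i.+1 n f & forall s, f (l s) = r s].
pose lost_fork i (S : {set X}) (p : D * D) (w : seq (X * bool)) := exists n
  (a : n.-tuplelexi X), [/\ [set x in a]%SET = S, mark [::] a = w,
    fork (C i n) a p & ~ fork (C i.+1 n) a p].
have lost i : exists lw : label * seq (X * bool),
    match lw.1 with
    | inl (cs, r) => lost_rows i cs r
    | inr (cs, p) => lost_fork i cs p lw.2
    end.
  have /existsNP[n notsub] := strict i; apply: contrapT => /forallNP none.
  apply: notsub; apply: (forks_determine_subpower _ k2 edge_t (closedC _ _) (@decC _ _)).
  - exact: [tuple of nseq n x0].
  - move=> a p forkp; apply: contrapT => nforkp.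
    by apply: (none (inr ([set x in a]%SET, p), mark [::] a)); exists n, a.
  move=> g Cg l; apply: contrapT => nol.
  apply: (none (inl (columns l, [ffun s => g (l s)]), [::])); exists n, l.
  split=> //; first by exists g => // s; rewrite ffunE.
  by move=> [f Cf fl]; apply: nol; exists f => // s; rewrite fl ffunE.
have [lw lwP] := choice lost.
have [i [j [lt_ij [eq_l sub]]]] := higman lw.
have := lwP i; have := lwP j; rewrite eq_l.
case: (lw j).1 => -[cs r].
  move=> [n [l [colS [f Cf fl] _]]] [n' [l' [colS' _ []]]].
  have [|sigma sigmaP] := @columns_minor _ _ _ _ l' l; first by rewrite colS.
  exists (f \o minor sigma) => [|s]; last by rewrite /= sigmaP.
  exact/minC/(decC_lt i j).
move=> [n [b [bS markb forkb _]]] [m [a [aS marka _ []]]].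
have [||sigma ord_sigma eq_b] := @mark_subseq_reindex X m n a b.
- by rewrite marka markb.
- by move=> x; have /setP/(_ x) := aS; rewrite -bS !inE => ->.
apply: (fork_minor (minC i.+1) ord_sigma).
have := forkb; rewrite {1}eq_b => -[u [v [Cu Cv uv ->]]].
by exists u, v; split=> //; apply: (decC_lt i j).
Qed.

(** * From subvarieties to clonoids *)

Fixpoint bind (S : signature) (X Y : Type) (sigma : X -> term S Y) (s : term S X) :
    term S Y :=
  match s with
  | Var x => sigma x
  | App f ss => App (fun i => bind sigma (ss i))
  end.

Lemma eval_bind (S : signature) (B : algebra S) (X Y : Type)
    (sigma : X -> term S Y) (v : Y -> B) (s : term S X) :
  eval v (bind sigma s) = eval (fun x => eval v (sigma x)) s.
Proof. by elim: s => //= f ss IHss; congr interp; apply/funext. Qed.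

Definition rename (S : signature) (X Y : Type) (sigma : X -> Y) : term S X -> term S Y :=
  bind (fun x => Var S (sigma x)).

Lemma eval_rename (S : signature) (B : algebra S) (X Y : Type)
    (sigma : X -> Y) (v : Y -> B) (s : term S X) :
  eval v (rename sigma s) = eval (v \o sigma) s.
Proof. exact: eval_bind. Qed.

Lemma finite_support (S : signature) (s : term S nat) :
  exists n0, forall n, n0 <= n -> exists s' : term S 'I_n, s = rename val s'.
Proof.
elim: s => [x | f ss /choice[N IHss]].
  by exists x.+1 => n lt_xn; exists (Var S (Ordinal lt_xn)).
exists (\max_i N i) => n le_Nn.
have /choice[ss' ssE] i : exists s' : term S 'I_n, ss i = rename val s'.
  by apply: IHss; apply: leq_trans le_Nn; apply: leq_bigmax.
by exists (App ss'); rewrite /rename /=; congr App; apply/funext.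
Qed.

Definition theory (S : signature) (V : set (algebra S)) : set (identity S) :=
  [set e | forall B, V B -> satisfies B e].

Lemma theoryP (S : signature) (V : set (algebra S)) (n : nat) (s t : term S 'I_n) :
  theory V (rename val s, rename val t) <->
  forall B, V B -> forall v : nat -> B, eval (v \o val) s = eval (v \o val) t.
Proof.
by split=> thV B VB v; have := thV B VB v; rewrite /= !eval_rename.
Qed.

Lemma variety_properD (S : signature) (V W : set (algebra S)) :
  is_variety V -> V `<` W -> exists2 e, theory V e & ~ theory W e.
Proof.
move=> [E ->] [_ notWV]; apply: contrapT => none; apply: notWV => B WB e Ee.
apply: contrapT => notBe; apply: none; exists e; first by move=> B' /(_ e Ee).
by move=> /(_ B WB).
Qed.

(** The carrier of [A] is coded by a type [X], later an ordinal, because the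
    chain condition is about functions between finite ordered types. *)
Section Clonoid.

Variables (S : signature) (A : algebra S) (X : Type) (dec : X -> A) (enc : A -> X).
Hypotheses (encK : cancel enc dec) (decK : cancel dec enc).

Definition pair_function (n : nat) (s t : term S 'I_n) (w : n.-tuple X) : X * X :=
  (enc (eval (dec \o tnth w) s), enc (eval (dec \o tnth w) t)).

Definition theory_clonoid (V : set (algebra S)) (n : nat) : set (n.-tuple X -> X * X) :=
  [set f | exists s t : term S 'I_n,
     theory V (rename val s, rename val t) /\ f = pair_function s t].

Definition square_operation (k : nat) (g : ('I_k -> A) -> A)
    (r : 'I_k -> X * X) : X * X :=
  (enc (g (fun j => dec (r j).1)), enc (g (fun j => dec (r j).2))).

Lemma square_edge (k : nat) (g : ('I_k.+1 -> A) -> A) :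
  is_edge_operation g -> is_edge_operation (square_operation g).
Proof.
move=> edge_g x y.
have [g1 g2 g3] := edge_g (dec x.1) (dec y.1).
have [h1 h2 h3] := edge_g (dec x.2) (dec y.2).
have if_fst (b : bool) : dec (if b then y else x).1 = if b then dec y.1 else dec x.1.
  by case: b.
have if_snd (b : bool) : dec (if b then y else x).2 = if b then dec y.2 else dec x.2.
  by case: b.
rewrite /square_operation; split=> [||i i3]; under eq_fun do rewrite if_fst;
  under [X in (_, enc (g X))]eq_fun do rewrite if_snd.
- by rewrite g1 h1 !decK -surjective_pairing.
- by rewrite g2 h2 !decK -surjective_pairing.
- by rewrite g3 // h3 // !decK -surjective_pairing.
Qed.

Lemma theory_clonoid_closed (V : set (algebra S)) (k : nat)
    (g : ('I_k -> A) -> A) (n : nat) :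
  is_term_function g -> closed_under (square_operation g) (@theory_clonoid V n).
Proof.
move=> [p gE] fs /choice[s /choice[t /all_and2[thV fsE]]].
exists (bind s p), (bind t p); split.
  apply/theoryP => B VB v; rewrite !eval_bind; congr eval; apply/funext => j.
  by have /theoryP := thV j; apply.
apply/funext => w; rewrite /pair_function /square_operation !eval_bind !gE.
by congr (_, _); congr (enc (eval _ _)); apply/funext => j; rewrite fsE /= encK.
Qed.

Lemma theory_clonoid_minor (V : set (algebra S)) : minor_closed (theory_clonoid V).
Proof.
move=> m n sigma _ [s [t [thV ->]]].
exists (rename sigma s), (rename sigma t); split.
  apply/theoryP => B VB v; rewrite !eval_rename.
  (* [v \o sigma] is extended beyond [n] by the arbitrary value [v 0]. *)
  have /theoryP/(_ B VB)-/(_ (fun j =>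
    if insub j is Some i then v (sigma i) else v 0)) := thV.
  set v1 := _ \o val; suff -> : v1 = (v \o val) \o sigma by [].
  by apply/funext => i; rewrite /v1 /= valK.
apply/funext => w; rewrite /pair_function /= !eval_rename.
by congr (_, _); congr (enc (eval _ _)); apply/funext => j; rewrite /= tnth_mktuple.
Qed.

Lemma theory_clonoidS (V W : set (algebra S)) (n : nat) :
  V `<=` W -> @theory_clonoid W n `<=` @theory_clonoid V n.
Proof.
move=> sVW _ [s [t [thW ->]]]; exists s, t; split=> // B VB.
by apply: thW; apply: sVW.
Qed.

(** The clonoid determines the theory because two terms inducing the same
    function on [A] are interchangeable in every member of the variety generated
    by [A]. *)
Lemma theory_clonoid_reflects (V W : set (algebra S)) :
  W `<=` variety_of A ->
  (forall n, @theory_clonoid V n `<=` @theory_clonoid W n) -> theory V `<=` theory W.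
Proof.
move=> sWA sub [s t] thV.
have [ns suppS] := finite_support s; have [nt suppT] := finite_support t.
have [s' sE] := suppS _ (leq_maxl ns nt); have [t' tE] := suppT _ (leq_maxr ns nt).
have [|s2 [t2 [thW eq_st]]] := sub _ (pair_function s' t').
  by exists s', t'; rewrite -sE -tE.
set n := maxn ns nt in s' t' sE tE s2 t2 thW eq_st.
have eqA (u u2 : term S 'I_n) :
    (forall w, eval (dec \o tnth w) u = eval (dec \o tnth w) u2) ->
    satisfies A (rename val u, rename val u2).
  move=> eq_u v; rewrite /= !eval_rename.
  have := eq_u [tuple enc (v i) | i < n].
  suff -> : dec \o tnth [tuple enc (v i) | i < n] = v \o val by [].
  by apply/funext => i; rewrite /= tnth_mktuple encK.
have decI := can_inj encK.
have sA := eqA s' s2 (fun w => decI _ _ (congr1 fst (congr1 (@^~ w) eq_st))).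
have tA := eqA t' t2 (fun w => decI _ _ (congr1 snd (congr1 (@^~ w) eq_st))).
move=> B WB v; rewrite sE tE.
have /= -> := sWA B WB _ sA v; have /= -> := sWA B WB _ tA v.
exact: thW.
Qed.

End Clonoid.

Lemma finite_ordinal_bij (T : Type) : finite_set [set: T] ->
  exists (m : nat) (dec : 'I_m -> T) (enc : T -> 'I_m), cancel enc dec /\ cancel dec enc.
Proof.
move=> [m /card_set_bijP[f [f_fun f_inj f_surj]]].
pose enc x := Ordinal (f_fun x I : f x < m).
have /choice[dec decK] (i : 'I_m) : exists x, enc x = i.
  have [x _ fx] := f_surj i (ltn_ord i).
  by exists x; apply: val_inj.
exists m, dec, enc; split=> // x; apply: f_inj; rewrite ?inE //.
exact: (congr1 val (decK (enc x))).
Qed.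

Theorem theorem1p1 (S : signature) (A : algebra S)
    (finA : finite_set [set: A]) (edgeA : has_edge_term A) :
  ~ exists V : nat -> set (algebra S),
      (forall i, is_subvariety (V i) (variety_of A)) /\
      (forall i, V i `<` V i.+1).
Proof.
move=> [V [subV chain]].
have [m [dec [enc [encK decK]]]] := finite_ordinal_bij finA.
have [k [g [k2 term_g edge_g]]] := edgeA.
have lost i := variety_properD (subV i).1 (chain i).
(* If [A] were empty, it would satisfy every identity, including the lost ones. *)
have [x0 _] : exists x : 'I_m, True.
  apply: contrapT => noX; have [e _ []] := lost 0 => B VB.
  have [_ sVA] := subV 1; apply: (sVA B VB) => v.
  by case: noX; exists (enc (v 0)).
have [i stop] : exists i, forall n,
    @theory_clonoid _ _ _ dec enc (V i) n `<=` @theory_clonoid _ _ _ dec enc (V i.+1) n.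
  apply: (clonoid_chain_stops x0 k2 (square_edge decK edge_g)).
  - by move=> i n; apply: theory_clonoid_closed.
  - by move=> i; apply: theory_clonoid_minor.
  - by move=> i n; apply: theory_clonoidS; have [] := chain i.
have [e thV []] := lost i.
exact: (theory_clonoid_reflects encK (subV i.+1).2 stop).
Qed.
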